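(* Let $n\ge 1$ and let $\mathscr{C}_0,\mathscr{C}_1\subseteq\mathbb{F}_2^n$ be two binary linear codes of length $n$ with weight distributions $A^{(i)}(X)=\sum_{j=0}^{n}A^{(i)}_jX^j$, $i=0,1$, where $A^{(i)}_j$ is the number of codewords of Hamming weight $j$ in $\mathscr{C}_i$. Let $\Pi$ be a uniformly distributed random $n\times n$ permutation matrix, and let $$\mathscr{C}=\{(\bm{u}+\bm{v}\Pi,\ \bm{v})\ :\ \bm{u}\in\mathscr{C}_0,\ \bm{v}\in\mathscr{C}_1\}\subseteq\mathbb{F}_2^{2n}.$$ Then the (ensemble) weight distribution of $\mathscr{C}$ is $A(X)=\sum_{w=0}^{2n}A_wX^w$, where $A_w$, the expected number (over $\Pi$) of codewords of Hamming weight $w$ in $\mathscr{C}$, is given for every integer $0\le w\le 2n$ by $$A_w=\sum_{w_1=\max\{0,\,w-n\}}^{\min\{w,\,n\}}\ \sum_{i=\max\{0,\,w-n\}}^{\min\{w_1,\,w-w_1\}}a(w_1,i)\,A^{(1)}_{w_1}\,A^{(0)}_{w-2i},$$ with $$a(w_1,i)=\frac{\binom{n}{w-w_1}\binom{w-w_1}{i}\binom{n-w+w_1}{w_1-i}}{\binom{n}{w_1}\binom{n}{w-2i}}.$$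
   Context: The Hamming weight of a binary vector is the number of its nonzero coordinates. Vectors are row vectors, so $\bm{v}\Pi$ is the vector obtained from $\bm{v}$ by permuting its coordinates. ''Uniformly distributed random permutation matrix'' means that $\Pi$ is chosen uniformly among the $n!$ permutation matrices of order $n$. Since $\mathscr{C}$ depends on the random $\Pi$, its weight distribution is understood as the ensemble weight distribution: $A_w=\mathbb{E}_\Pi\left[\,\left|\{\bm{c}\in\mathscr{C}: \bm{c}\text{ has Hamming weight }w\}\right|\,\right]$, the average over all $n!$ permutation matrices. The coefficient $a(w_1,i)$ depends also on $n$ and $w$; an inner sum whose lower limit exceeds its upper limit is empty. *)

(* Defs.v *)
From HB Require Import structures.
From mathcomp Require Import all_boot all_order all_fingroup all_algebra.

Set Implicit Arguments.
Unset Strict Implicit.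
Unset Printing Implicit Defensive.

Import Order.TTheory GRing.Theory Num.Theory.
Local Open Scope ring_scope.

Definition hweight (m : nat) (x : 'rV['F_2]_m) : nat :=
  #|[set j : 'I_m | x 0 j != 0]|.

Definition weight_count (m : nat) (C : {pred 'rV['F_2]_m}) (j : nat) : nat :=
  #|[set x in C | hweight x == j]|.

Definition weight_distribution (m : nat) (C : {pred 'rV['F_2]_m}) :
    {poly rat} :=
  \sum_(0 <= j < m.+1) (weight_count C j)%:R *: 'X^j.

Definition perm_matrices (n : nat) : {set 'M['F_2]_n} :=
  [set P : 'M['F_2]_n | is_perm_mx P].

(* Expectation of [f P] for [P] uniform among the permutation matrices; the
   values lie in a rational vector space so that both numbers ([rat^o]) and
   generating polynomials ([{poly rat}]) can be averaged. *)
Definition perm_expectation (n : nat) (V : lmodType rat)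
    (f : 'M['F_2]_n -> V) : V :=
  (#|perm_matrices n|%:R)^-1 *: \sum_(P in perm_matrices n) f P.

Definition superposition_code (n : nat) (C0 C1 : {vspace 'rV['F_2]_n})
    (P : 'M['F_2]_n) : {set 'rV['F_2]_(n + n)} :=
  [set row_mx (u + v *m P) v | u in C0, v in C1].

Definition ensemble_count (n : nat) (C0 C1 : {vspace 'rV['F_2]_n})
    (w : nat) : rat :=
  @perm_expectation n rat^o
    (fun P => (weight_count (superposition_code C0 C1 P) w)%:R).

Definition ensemble_distribution (n : nat)
    (C0 C1 : {vspace 'rV['F_2]_n}) : {poly rat} :=
  perm_expectation
    (fun P => weight_distribution (superposition_code C0 C1 P)).

(* The binomial with upper entry n - w + w1 is written with n + w1 - w because
   subtraction on nat truncates and w may exceed n; in the range of use,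
   w <= n + w1, w1 <= w and 2 * i <= w, so no subtraction truncates. *)
Definition mixing_coef (n w w1 i : nat) : rat :=
  ('C(n, w - w1) * 'C(w - w1, i) * 'C(n + w1 - w, w1 - i))%N%:R
  / ('C(n, w1) * 'C(n, w - 2 * i))%N%:R.

(* Main.v *)
(** Fix u in C0 and v in C1 with supports U and V, |V| = w1. For uniform P the
    support of vP is uniform among the w1-subsets of the coordinates, because
    permutations act transitively on subsets of a given size. The codeword
    (u + vP, v) has weight w exactly when |U| = w - 2i, where i is the number of
    coordinates of vP outside U; so U and w determine i, and the event is that
    vP meets U in w1 - i points. Its hypergeometric probability
    'C(|U|, w1 - i) 'C(n - |U|, i) / 'C(n, w1) equals [mixing_coef n w w1 i], as
    both numerators, put over the same denominator, are the multinomial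
    coefficient of the parts w1 - i, w - w1 - i, i and n - w + i. Summing over u
    and v gives the formula. *)

Require Import Defs.
From HB Require Import structures.
From mathcomp Require Import all_boot all_order all_fingroup all_algebra.
From mathcomp Require Import zify ring.

Set Implicit Arguments.
Unset Strict Implicit.
Unset Printing Implicit Defensive.

Import Order.TTheory GRing.Theory Num.Theory.
Local Open Scope ring_scope.

(** * Counting permutations by the image of a set *)

(** Each side is the multinomial coefficient of the parts [a], [b], [c], [d]: the left splits off
    [a + b] first, the right [b + c]. *)
Lemma binomial_regroup (a b c d : nat) :
  ('C(a + b + c + d, a + b) * 'C(a + b, a) * 'C(c + d, c)
   = 'C(a + b + c + d, b + c) * 'C(b + c, c) * 'C(a + d, a))%N.
Proof.
have bf x y : ('C(x + y, x) * (x`! * y`!) = (x + y)`!)%N.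
  by rewrite -[in y`!](addKn x y) bin_fact // leq_addr.
have Hl : ('C(a + b + c + d, a + b) * 'C(a + b, a) * 'C(c + d, c)
   * (a`! * b`! * (c`! * d`!)) = (a + b + c + d)`!)%N.
  rewrite -[in RHS]addnA -bf -[in RHS](bf a b) -[in RHS](bf c d).
  by rewrite -[(a + b + c + d)%N]addnA; lia.
have Hr : ('C(a + b + c + d, b + c) * 'C(b + c, c) * 'C(a + d, a)
   * (a`! * b`! * (c`! * d`!)) = (a + b + c + d)`!)%N.
  have -> : (a + b + c + d = (b + c) + (a + d))%N by lia.
  rewrite -bf -[in RHS](bf a d) [in RHS](addnC b c) -[in RHS](bf c b).
  by rewrite [(c + b)%N]addnC; lia.
apply/eqP; rewrite -(@eqn_pmul2r (a`! * b`! * (c`! * d`!))) ?muln_gt0 ?fact_gt0 //.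
by rewrite Hl Hr.
Qed.

(** Induction on [#|V :\: W|]: the transposition of a point of [V :\: W] with one of [W :\: V]
    lowers it. *)
Lemma perm_imset_exists (T : finType) (V W : {set T}) :
  #|V| = #|W| -> exists s : {perm T}, s @: V = W.
Proof.
have [k] := ubnP #|V :\: W|; elim: k V => // k IH V; rewrite ltnS => hk hVW.
have [/eqP VW0|[x xVW]] := set_0Vmem (V :\: W).
  exists 1%g; rewrite (eq_imset (g := id)) ?imset_id; last by move=> x; rewrite perm1.
  by apply/eqP; rewrite eqEcard hVW leqnn andbT -setD_eq0.
have [/eqP WV0|[y yWV]] := set_0Vmem (W :\: V).
  move: (eqEcard W V); rewrite -setD_eq0 WV0 hVW leqnn /= => /eqP WV.
  by move: xVW; rewrite WV setDv inE.
move: xVW yWV; rewrite !inE => /andP[xW xV] /andP[yV yW].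
have [||s hs] := IH (tperm x y @: V).
- apply: leq_trans hk; apply: proper_card; apply/properP; split.
    apply/subsetP=> z; rewrite !inE => /andP[zW /imsetP[z' z'V hz]].
    rewrite zW; move: hz zW; case: tpermP => [_ ->|z'y|_ _ -> //].
      by rewrite yW.
    by rewrite -z'y z'V in yV.
  exists x; rewrite !inE xW ?xV //=.
  apply/imsetP=> -[z zV]; case: tpermP => [_ xy|hz _|]; first by rewrite xy yW in xW.
    by rewrite -hz zV in yV.
  by move=> zx _ xz; rewrite xz in zx.
- by rewrite card_imset //; apply: perm_inj.
exists (tperm x y * s)%g; rewrite -hs -imset_comp; apply: eq_imset => z.
by rewrite permM.
Qed.

(** The fibres of [s @: V], as [s] varies, over the sets of size [#|V|] are equally large;
    cross-multiplying avoids division in [nat]. *)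
Lemma card_perm_imset (T : finType) (V : {set T}) (Q : pred {set T}) :
  (#|[set s : {perm T} | Q (s @: V)]| * 'C(#|T|, #|V|)
   = #|T|`! * #|[set W : {set T} | (#|W| == #|V|) && Q W]|)%N.
Proof.
pose N (W : {set T}) := #|[set s : {perm T} | s @: V == W]|.
have NV (W : {set T}) : #|W| = #|V| -> N W = N V.
  (* Right multiplication by [g] carries the fibre over [V] onto the fibre over [W]. *)
  move=> /esym /perm_imset_exists[g hg].
  rewrite /N -[RHS](card_imset _ (@mulIg _ g)); apply: eq_card => s.
  have E (r : {perm T}) : (r * g)%g @: V = g @: (r @: V).
    by rewrite -imset_comp; apply: eq_imset => z; rewrite permM.
  rewrite inE; apply/eqP/imsetP => [hs|[r]].
    exists (s * g^-1)%g; last by rewrite mulgKV.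
    rewrite inE; apply/eqP/(imset_inj (@perm_inj _ g)).
    by rewrite -E mulgKV hs hg.
  by rewrite inE => /eqP hr ->; rewrite E hr.
have key (R : pred {set T}) : (#|[set s : {perm T} | R (s @: V)]|
    = N V * #|[set W : {set T} | (#|W| == #|V|) && R W]|)%N.
  rewrite -sum1dep_card (partition_big (fun s : {perm T} => s @: V)
    (fun W : {set T} => (#|W| == #|V|) && R W)) /=; last first.
    by move=> s ->; rewrite andbT card_imset //; apply: perm_inj.
  rewrite mulnC -sum_nat_const; apply: eq_big => [W|W /andP[/eqP hW RW]].
    by rewrite inE.
  rewrite sum1dep_card -(NV W) // /N; apply: eq_card => s; rewrite !inE.
  by case: eqP => [->|]; rewrite ?RW ?andbF.
(* With [predT] all permutations are counted, which determines [N V]. *)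
have := key predT; rewrite (eq_card (B := predT)) => [|s]; last by rewrite inE.
rewrite (eq_card (B := [set W : {set T} | #|W| == #|V|])); last first.
  by move=> W; rewrite !inE andbT.
rewrite card_draws key => hT.
have -> : #|T|`! = #|{perm T}|.
  rewrite -[#|T|]cardsT -card_perm; apply: eq_card => s.
  by rewrite [RHS]inE; apply/subsetP=> x; rewrite inE.
by rewrite hT mulnAC.
Qed.

(** The parts of [W] inside and outside [U] determine [W] and can be chosen independently. *)
Lemma card_draws_meet (T : finType) (U : {set T}) (t r : nat) :
  #|[set W : {set T} | (#|W| == (t + r)%N) && (#|U :&: W| == t)]|
  = ('C(#|U|, t) * 'C(#|T| - #|U|, r))%N.
Proof.
have -> : (#|T| - #|U| = #|~: U|)%N by rewrite [RHS]cardsCs setCK.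
rewrite -!cards_draws -cardsX.
pose f (W : {set T}) := (W :&: U, W :&: ~: U).
rewrite -(card_imset _ (f := f)); last first.
  by move=> W W' [hU hC]; rewrite -(setID W U) -(setID W' U) !setDE hU hC.
apply: eq_card => -[X Y]; rewrite !inE /=.
apply/imsetP/idP => [[W]|].
  rewrite inE => /andP[/eqP hW /eqP ht] [-> ->]; rewrite !subsetIr /= setIC ht eqxx /=.
  by move: (cardsID U W); rewrite hW setIC ht setDE => /addnI ->.
case/andP=> /andP[XU /eqP hX] /andP[YU /eqP hY].
have XUY : (X :|: Y) :&: U = X.
  rewrite setIUl (setIidPl XU); apply/setUidPl.
  by rewrite (_ : Y :&: U = set0) ?sub0set //; apply/disjoint_setI0; rewrite disjoints_subset.
have YUX : (X :|: Y) :&: ~: U = Y.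
  rewrite setIUl (setIidPl YU); apply/setUidPr.
  by rewrite -setDE (_ : X :\: U = set0) ?sub0set //; apply/eqP; rewrite setD_eq0.
exists (X :|: Y); last by rewrite /f XUY YUX.
rewrite inE setIC XUY hX eqxx andbT -(cardsID U) XUY setDE YUX.
by rewrite hX hY.
Qed.

(** * Supports and Hamming weights *)

Definition support_set (n : nat) (v : 'rV['F_2]_n) : {set 'I_n} :=
  [set j | v 0 j != 0].

Lemma support_set_perm (n : nat) (v : 'rV['F_2]_n) (s : 'S_n) :
  support_set (v *m perm_mx s) = s @: support_set v.
Proof.
rewrite -[s]invgK -col_permE; apply/setP=> j; rewrite inE mxE invgK.
by rewrite -{2}[j](permKV s) (mem_imset _ _ (@perm_inj _ s)) inE.
Qed.

Lemma support_setD (n : nat) (u v : 'rV['F_2]_n) :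
  support_set (u + v)
  = (support_set u :\: support_set v) :|: (support_set v :\: support_set u).
Proof.
apply/setP=> j; rewrite !inE mxE.
by case: (u 0 j) (v 0 j) => [[|[|//]] ?] [[|[|//]] ?].
Qed.

Lemma card_symdiff (T : finType) (A B : {set T}) :
  (#|(A :\: B) :|: (B :\: A)| + 2 * #|A :&: B| = #|A| + #|B|)%N.
Proof.
rewrite cardsU (_ : _ :&: (B :\: A) = set0); last first.
  by apply/setP=> x; rewrite !inE; case: (x \in A); case: (x \in B).
have := cardsID A B; have := cardsID B A.
rewrite cards0 (setIC B); lia.
Qed.

Lemma hweightE (n : nat) (v : 'rV['F_2]_n) : hweight v = #|support_set v|.
Proof. by []. Qed.

Lemma hweightD (n : nat) (u v : 'rV['F_2]_n) :
  (hweight (u + v) + 2 * #|support_set u :&: support_set v|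
   = hweight u + hweight v)%N.
Proof. by rewrite !hweightE support_setD card_symdiff. Qed.

Lemma hweight_perm (n : nat) (v : 'rV['F_2]_n) (s : 'S_n) :
  hweight (v *m perm_mx s) = hweight v.
Proof.
by rewrite !hweightE support_set_perm card_imset //; apply: perm_inj.
Qed.

(** * Permutations that give a prescribed weight *)

Lemma card_perm_meet (n : nat) (U V : {set 'I_n}) (w i : nat) :
  (i <= #|V|)%N -> (#|V| + i <= w)%N -> w = (#|U| + 2 * i)%N -> (w <= n + i)%N ->
  #|[set s : 'S_n | #|U :&: (s @: V)| == (#|V| - i)%N]|%:R
  = n`!%:R * mixing_coef n w #|V| i :> rat.
Proof.
move=> iV Vw wU wn.
have := card_perm_imset V (fun W => #|U :&: W| == #|V| - i)%N.
rewrite -{3}(subnK iV) card_draws_meet card_ord /mixing_coef => /(congr1 (fun m => m%:R : rat)).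
have leV : (#|V| <= n)%N by rewrite -[n in leqRHS]card_ord max_card.
have nzV : 'C(n, #|V|)%:R != 0 :> rat by rewrite pnatr_eq0 -lt0n bin_gt0.
have nzU : 'C(n, w - 2 * i)%:R != 0 :> rat by rewrite pnatr_eq0 -lt0n bin_gt0; lia.
(* For a counted [s], these are the numbers of points in both [U] and [s @: V], in [U] only, in
   [s @: V] only, and in neither. The hypotheses prevent truncation. *)
have /(congr1 (fun m => m%:R : rat)) :=
  binomial_regroup (#|V| - i) (w - #|V| - i) i (n + i - w).
have -> : (#|V| - i + (w - #|V| - i) + i + (n + i - w) = n)%N by lia.
have -> : (#|V| - i + (w - #|V| - i) = w - 2 * i)%N by lia.
have -> : (w - #|V| - i + i = w - #|V|)%N by lia.
have -> : (#|V| - i + (n + i - w) = n + #|V| - w)%N by lia.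
have -> : (i + (n + i - w) = n - #|U|)%N by lia.
have -> : (#|U| = w - 2 * i)%N by lia.
rewrite !natrM => <- /(canRL (mulfK nzV)) ->.
by field; rewrite nzV nzU.
Qed.

(** At most one term of the double sum is nonzero. The indicators are there to become weight counts
    once [u] and [v] are summed over. *)
Lemma card_perm_weight (n : nat) (u v : 'rV['F_2]_n) (w : nat) :
  #|[set s : 'S_n | hweight (u + v *m perm_mx s) + hweight v == w]%N|%:R
  = n`!%:R * (\sum_(maxn 0 (w - n) <= w1 < (minn w n).+1)
      \sum_(maxn 0 (w - n) <= i < (minn w1 (w - w1)).+1)
        mixing_coef n w w1 i
        * (hweight v == w1)%:R * (hweight u == w - 2 * i)%N%:R) :> rat.
Proof.
(* The only possible [i] with [w = hweight u + 2 * i]; if [w - hweight u] is odd or truncates, that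
   equality fails for [i0]. *)
set i0 := ((w - hweight u)./2)%N.
have leW (x : 'rV['F_2]_n) : (hweight x <= n)%N.
  by rewrite -[n in leqRHS]card_ord max_card.
have := leW u; have := leW v; move=> lev leu.
(* Either the pair [hweight v], [i0] lies in the summation ranges and gives the one surviving term,
   or both sides vanish. *)
have [/and5P[h1 h2 /eqP h3 h4 h5]|hN] := boolP [&& w - n <= i0, i0 <= hweight v,
  w == hweight u + 2 * i0, hweight v + i0 <= w & w - n <= hweight v]%N.
  rewrite (bigD1_seq (hweight v)) ?iota_uniq ?mem_index_iota //=; last by lia.
  rewrite [X in _ + X]big1 => [|w1 w1v]; last first.
    by apply: big1 => i _; rewrite eq_sym (negPf w1v) mulr0 mul0r.
  rewrite (bigD1_seq i0) ?iota_uniq ?mem_index_iota //=; last by lia.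
  rewrite [X in _ + X + _]big_seq_cond big1 => [|i]; last first.
    rewrite mem_index_iota => /andP[ir ii0].
    by rewrite (_ : (hweight u == _) = false) ?mulr0 //; lia.
  rewrite eqxx (_ : (hweight u == _)); last by lia.
  rewrite !mulr1 !addr0.
  rewrite (_ : mixing_coef _ _ _ _ = mixing_coef n w #|support_set v| i0) //.
  rewrite -(@card_perm_meet _ (support_set u)) -?hweightE //; last by lia.
  congr _%:R; apply: eq_card => s; rewrite !inE -support_set_perm.
  have := hweightD u (v *m perm_mx s); rewrite hweight_perm.
  by move: #|_ :&: _| => t hD; apply/eqP/eqP; lia.
(* A counted [s] would give [i0 = hweight v - t], with [t] the size of the intersection of the
   supports. The bounds on [t] and on the size of their union then yield all the excluded
   conditions. *)
rewrite (eq_card0 (A := [set _ | _])) => [|s]; last first.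
  rewrite inE; apply/negP => /eqP hw; move/negP: hN; apply.
  have := hweightD u (v *m perm_mx s); rewrite hweight_perm => hD.
  have := leW (u + v *m perm_mx s).
  set t := #|_| in hD.
  have t1 : (t <= hweight u)%N by apply/subset_leq_card/subsetIl.
  have t2 : (t <= hweight v)%N.
    by rewrite -(hweight_perm v s); apply/subset_leq_card/subsetIr.
  have t3 : (hweight u + hweight v - t <= n)%N.
    rewrite -(hweight_perm v s) -[n in leqRHS]card_ord.
    by rewrite /t !hweightE -cardsU max_card.
  by move=> t4; rewrite /i0; apply/and5P; split; lia.
rewrite big_seq big1 ?mulr0 // => w1; rewrite mem_index_iota => rw1.
rewrite big_seq big1 // => i; rewrite mem_index_iota => ri.
case: eqP => [vw1|]; last by rewrite mulr0 mul0r.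
case: eqP => [uwi|]; last by rewrite mulr0.
by case/negP: hN; apply/and5P; rewrite /i0; split; lia.
Qed.

(** * Codeword counts and the expectation as sums *)

Lemma weight_countE (n : nat) (C : {pred 'rV['F_2]_n}) (j : nat) :
  (weight_count C j)%:R = \sum_(x in C) (hweight x == j)%:R :> rat.
Proof.
rewrite /weight_count -sum1dep_card natr_sum big_mkcondr /=.
by apply: eq_bigr => x _; case: eqP.
Qed.

Lemma hweight_row_mx (m n : nat) (x : 'rV['F_2]_m) (y : 'rV['F_2]_n) :
  hweight (row_mx x y) = (hweight x + hweight y)%N.
Proof.
rewrite /hweight !cardsE -!sum1_card big_split_ord /=.
by congr (_ + _)%N; apply: eq_bigl => j; rewrite /in_mem /= (row_mxEl, row_mxEr).
Qed.

Lemma weight_count_superposition (n : nat) (C0 C1 : {vspace 'rV['F_2]_n})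
    (P : 'M['F_2]_n) (w : nat) :
  (weight_count (superposition_code C0 C1 P) w)%:R
  = \sum_(v in C1) \sum_(u in C0) (hweight (u + v *m P) + hweight v == w)%N%:R :> rat.
Proof.
rewrite weight_countE /superposition_code.
rewrite (_ : [set _ | _ in _, _ in _] =
  [set row_mx (p.1 + p.2 *m P) p.2
     | p in [pred p | (p.1 \in C0) && (p.2 \in C1)]]); last first.
  apply/setP=> x; apply/imset2P/imsetP => [[u v hu hv ->]|[[u v] /andP[hu hv] ->]].
    by exists (u, v); rewrite ?inE ?hu.
  by exists u v.
(* The second half of a codeword gives back [v], and the first half then gives [u], so no codeword
   is counted twice. *)
rewrite big_imset => [|[u v] [u' v'] _ _ /= /eq_row_mx[h vv]]; last first.
  by move: h; rewrite vv => /addIr ->.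
rewrite exchange_big pair_big /=; apply: eq_big => [p|p _]; first by rewrite inE.
by rewrite hweight_row_mx.
Qed.

Lemma perm_mx_inj (n : nat) : injective (@perm_mx 'F_2 n).
Proof.
move=> s t /matrixP st; apply/permP=> i; move: (st i (s i)); rewrite !mxE eqxx.
by case: eqP.
Qed.

Lemma perm_matricesE (n : nat) :
  perm_matrices n = [set perm_mx s | s : 'S_n].
Proof.
apply/setP=> P; rewrite inE; apply/is_perm_mxP/imsetP => [[s ->]|[s _ ->]].
  by exists s.
by exists s.
Qed.

Lemma perm_expectationE (n : nat) (V : lmodType rat) (f : 'M['F_2]_n -> V) :
  perm_expectation f = (n`!%:R)^-1 *: \sum_(s : 'S_n) f (perm_mx s).
Proof.
rewrite /perm_expectation perm_matricesE card_imset; last exact: perm_mx_inj.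
rewrite big_imset; last by move=> s t _ _; apply: perm_mx_inj.
by rewrite card_Sn.
Qed.

Theorem theorem1 (n : nat) (C0 C1 : {vspace 'rV['F_2]_n}) (hn : (1 <= n)%N) :
  ensemble_distribution C0 C1
    = \sum_(0 <= w < (2 * n).+1) ensemble_count C0 C1 w *: 'X^w
  /\
  forall w : nat, (w <= 2 * n)%N ->
    ensemble_count C0 C1 w
    = \sum_(maxn 0 (w - n) <= w1 < (minn w n).+1)
        \sum_(maxn 0 (w - n) <= i < (minn w1 (w - w1)).+1)
          mixing_coef n w w1 i
          * (weight_count C1 w1)%:R * (weight_count C0 (w - 2 * i))%:R.
Proof.
split=> [|w _].
  rewrite /ensemble_distribution /perm_expectation /weight_distribution.
  rewrite exchange_big scaler_sumr mul2n -addnn /=; apply: eq_bigr => w _.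
  by rewrite -scaler_suml scalerA.
rewrite /ensemble_count perm_expectationE /GRing.scale /=.
have nz : n`!%:R != 0 :> rat by rewrite pnatr_eq0 -lt0n fact_gt0.
apply: (canLR (mulKf nz)).
(* Double counting: for fixed [u] and [v], count the permutations that give weight [w]. *)
transitivity (\sum_(v in C1) \sum_(u in C0)
   #|[set s : 'S_n | hweight (u + v *m perm_mx s) + hweight v == w]%N|%:R : rat).
  under eq_bigr do rewrite weight_count_superposition.
  rewrite exchange_big; apply: eq_bigr => v _.
  rewrite exchange_big; apply: eq_bigr => u _.
  rewrite -sum1dep_card natr_sum [RHS]big_mkcond /=; apply: eq_bigr => s _.
  by case: eqP.
rewrite (eq_bigr _ (fun v _ => eq_bigr _ (fun u _ => card_perm_weight u v w))).
under eq_bigr do rewrite -mulr_sumr exchange_big.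
rewrite -mulr_sumr exchange_big; congr (_ * _); apply: eq_bigr => w1 _.
under eq_bigr do rewrite exchange_big.
rewrite exchange_big; apply: eq_bigr => i _.
(* For fixed [w1] and [i] the indicators separate [u] from [v], so the double sum is a product of
   two weight counts. *)
rewrite !weight_countE -mulrA big_distrlr mulr_sumr.
apply: eq_bigr => v _; rewrite mulr_sumr; apply: eq_bigr => u _.
by rewrite mulrA.
Qed.
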